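(* Let $c>-3$ and let $\mathscr{M}^3(c)=(\mathrm{SU}(2),g)$ be the Berger $3$-sphere. Let $X=X_{\mathfrak k}+X_{\mathfrak m}\in\mathfrak{g}=\mathfrak{k}\oplus\mathfrak{m}$ and let $\widehat{X}\in\mathfrak{p}(c)$ be the vector corresponding to $X$ under the identification $\mathfrak{p}(c)=T_{\mathbf{1}}\mathscr{M}^3(c)=\mathfrak{g}$. Then the geodesic of $\mathscr{M}^3(c)$ starting at the origin $\mathbf{1}$ with initial velocity $\widehat{X}$ (that is, $X$) is given explicitly by $$\gamma(t)=\exp_{G\times K}(t\widehat{X})\cdot\mathbf{1}=\exp_{G}\Bigl\{t\Bigl(X_{\mathfrak m}+\frac{4}{c+3}X_{\mathfrak k}\Bigr)\Bigr\}\,\exp_{K}\Bigl\{t\Bigl(\frac{c-1}{c+3}X_{\mathfrak k}\Bigr)\Bigr\}.$$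
   Context: Setting. $G=\mathrm{SU}(2)$ with identity $\mathbf{1}$ and Lie algebra $\mathfrak{g}=\mathfrak{su}(2)$, with basis $$\mathbf{i}=\begin{pmatrix}0&\sqrt{-1}\\ \sqrt{-1}&0\end{pmatrix},\quad \mathbf{j}=\begin{pmatrix}0&-1\\1&0\end{pmatrix},\quad \mathbf{k}=\begin{pmatrix}\sqrt{-1}&0\\0&-\sqrt{-1}\end{pmatrix}.$$ Let $E_1,E_2,E_3$ be the left invariant vector fields on $G$ with values $\mathbf{i},\mathbf{j},\mathbf{k}$ at $\mathbf{1}$. Let $g_1$ be the bi-invariant metric induced by $\langle X,Y\rangle_1=-\frac12\mathrm{tr}(XY)$, and let $\eta_1=g_1(E_3,\cdot)$. Berger sphere. For $c>-3$, $\mathscr{M}^3(c)=(G,g)$ with the left invariant metric $$g(X,Y)=\frac{4}{c+3}\Bigl(g_1(X,Y)-\frac{c-1}{c+3}\eta_1(X)\eta_1(Y)\Bigr).$$ Geodesics are taken with respect to the Levi-Civita connection of $g$. Homogeneous structure. $\mathfrak{k}=\mathbb{R}\mathbf{k}$, $\mathfrak{m}=\mathbb{R}\mathbf{i}\oplus\mathbb{R}\mathbf{j}$, and $K=\{\exp(s\mathbf{k})\mid s\in\mathbb{R}\}\subset G$. The group $G\times K$ acts isometrically and transitively on $\mathscr{M}^3(c)$ by $(a,k)\cdot x=axk^{-1}$, with isotropy group at $\mathbf{1}$ equal to $\Delta K=\{(k,k)\mid k\in K\}$. The tangent space $T_{\mathbf{1}}\mathscr{M}^3(c)=\mathfrak{g}$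 is identified with $$\mathfrak{p}(c)=\Bigl\{\bigl(V+W,\tfrac{1-c}{4}W\bigr)\;\Big|\;V\in\mathfrak{m},\,W\in\mathfrak{k}\Bigr\}\subset\mathfrak{g}\oplus\mathfrak{k}$$ by sending $X=X_{\mathfrak k}+X_{\mathfrak m}$ to $\widehat{X}=\bigl(X_{\mathfrak m}+\frac{4}{c+3}X_{\mathfrak k},\,-\frac{c-1}{c+3}X_{\mathfrak k}\bigr)$. $\exp_G,\exp_K,\exp_{G\times K}$ are the exponential maps of the respective Lie groups, and products of curves are taken in $G$. *)

(* Defs.v *)
From HB Require Import structures.
From mathcomp Require Import all_boot all_order all_algebra.
From mathcomp Require Import complex.
From mathcomp Require Import all_classical all_reals all_analysis.

Set Implicit Arguments.
Unset Strict Implicit.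
Unset Printing Implicit Defensive.

Import Order.TTheory GRing.Theory Num.Theory.
Import numFieldNormedType.Exports.

Local Open Scope ring_scope.
Local Open Scope complex_scope.
Local Open Scope classical_set_scope.
Local Open Scope sesquilinear_scope.

(* [R[i]] packed as a numClosedFieldType: in this form MathComp-Analysis gives
   ['M[cplx R]_2] and ['M[cplx R]_2 * 'M[cplx R]_2] their (sup) norm topology. *)
Definition cplx (R : realType) : numClosedFieldType := R[i].

Notation mat R := 'M[cplx R]_2.

(* Velocity of a curve with real parameter in a complex normed space. *)
Definition is_velocity (R : realType) (V : normedModType (cplx R))
    (gamma : R -> V) (t : R) (v : V) : Prop :=
  (fun h : R => (h^-1)%:C *: (gamma (t + h) - gamma t)) @ 0^' --> v.

Section LieExponential.
Variables (R : realType) (V : normedModType (cplx R)) (mul : V -> V -> V).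
Variable (H : set V).

(* The Lie group H is a subset of V, with multiplication [mul].  A homomorphism
   from the additive group of R that is differentiable at 0 is smooth. *)
Definition one_parameter_subgroup (X : V) (phi : R -> V) : Prop :=
  [/\ forall t, H (phi t),
      forall s t, phi (s + t) = mul (phi s) (phi t) &
      is_velocity phi 0 X].

(* Value at 1 of the one-parameter subgroup of H with initial velocity X;
   arbitrary when X is not in the Lie algebra of H. *)
Definition lie_exp (X : V) : V :=
  xget (fun=> 0) [set phi | one_parameter_subgroup X phi] 1.

End LieExponential.

Section SU2.
Variable R : realType.
Implicit Types (x u v A B : mat R) (X Y Z : mat R -> mat R) (f : mat R -> R).
Implicit Types (r t : R).

Definition SU2 : set (mat R) := [set x | x \is unitarymx /\ \det x = 1].
Definition su2 : set (mat R) := [set A | A ^t* = - A /\ \tr A = 0].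

Definition mx2 (a b c d : cplx R) : mat R :=
  \matrix_(p, q) (if p == 0 then (if q == 0 then a else b)
                  else (if q == 0 then c else d)).

Definition bi : mat R := mx2 0 (0 +i* 1) (0 +i* 1) 0.
Definition bj : mat R := mx2 0 (-1) 1 0.
Definition bk : mat R := mx2 (0 +i* 1) 0 0 (0 -i* 1).

Definition E (i : 'I_3) x : mat R := x * tnth [tuple bi; bj; bk] i.

Definition kfrak : set (mat R) := [set r%:C *: bk | r in setT].
Definition mfrak : set (mat R) :=
  [set A | exists r s : R, A = r%:C *: bi + s%:C *: bj].

Definition expG : mat R -> mat R := @lie_exp R (mat R) *%R SU2.
Definition K : set (mat R) := [set expG (s%:C *: bk) | s in setT].
Definition expK : mat R -> mat R := @lie_exp R (mat R) *%R K.
Definition expGK : mat R * mat R -> mat R * mat R := @lie_exp R (mat R * mat R)%type *%R (SU2 `*` K).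

Definition act (z : mat R * mat R) x : mat R := z.1 * x * z.2^-1.

(* Functions and vector fields on G = SU(2) are represented by maps defined on
   all 2x2 matrices; only their values on G are ever constrained. *)

(* (A f)(x), for A in su(2) seen as a left invariant vector field. *)
Definition lieD A f x : R :=
  derive1 (fun h : R => f (x * expG (h%:C *: A))) 0.

(* Derivative of f at x in the direction v tangent to G at x. *)
Definition tderiv f x v : R := lieD (x^-1 * v) f x.

(* Differentiability class C^n on G: as the left invariant fields span every
   tangent space, C^n means that all the iterated derivatives of order at most
   n along left invariant fields exist and are continuous on G. *)
Fixpoint Cn (n : nat) (f : mat R -> R) : Prop :=
  {within SU2, continuous f} /\
  if n is m.+1 then
    forall A, su2 A ->
      (forall x, SU2 x -> derivable (fun h : R => f (x * expG (h%:C *: A))) 0 1)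
      /\ Cn m (lieD A f)
  else True.

Definition smooth f : Prop := forall n, Cn n f.

Definition vector_field X : Prop :=
  exists a : 'I_3 -> mat R -> R,
    (forall i, smooth (a i)) /\
    forall x, SU2 x -> X x = \sum_(i < 3) (a i x)%:C *: E i x.

Definition app X f : mat R -> R :=
  fun x => tderiv f x (X x).

Definition inner1 A B : R := - 2^-1 * complex.Re (\tr (A *m B)).

Definition g1 x u v : R := inner1 (x^-1 * u) (x^-1 * v).

Definition eta1 x v : R := g1 x (E (inord 2) x) v.

Definition berger_metric (c : R) x u v : R :=
  4 / (c + 3) * (g1 x u v - (c - 1) / (c + 3) * eta1 x u * eta1 x v).

Definition connection := (mat R -> mat R) -> (mat R -> mat R) -> mat R -> mat R.

(* Linearity in Y over the reals is the Leibniz rule for constant f. *)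
Definition affine_connection (nabla : connection) : Prop :=
  [/\ forall X Y, vector_field X -> vector_field Y -> vector_field (nabla X Y),
      forall f X X' Y, smooth f ->
        vector_field X -> vector_field X' -> vector_field Y ->
        forall x, SU2 x ->
        nabla (fun y => (f y)%:C *: X y + X' y) Y x =
        (f x)%:C *: nabla X Y x + nabla X' Y x,
      forall X Y Y', vector_field X -> vector_field Y -> vector_field Y' ->
        forall x, SU2 x ->
        nabla X (fun y => Y y + Y' y) x = nabla X Y x + nabla X Y' x &
      forall f X Y, smooth f ->
        vector_field X -> vector_field Y ->
        forall x, SU2 x ->
        nabla X (fun y => (f y)%:C *: Y y) x =
        (app X f x)%:C *: Y x + (f x)%:C *: nabla X Y x].

(* nabla_X Y - nabla_Y X = [X, Y], both sides acting on functions as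
   derivations, with [X, Y] f = X (Y f) - Y (X f). *)
Definition torsion_free (nabla : connection) : Prop :=
  forall X Y f, vector_field X -> vector_field Y -> smooth f ->
  forall x, SU2 x ->
  tderiv f x (nabla X Y x - nabla Y X x) = app X (app Y f) x - app Y (app X f) x.

Definition metric_compatible (g : mat R -> mat R -> mat R -> R)
    (nabla : connection) : Prop :=
  forall X Y Z, vector_field X -> vector_field Y -> vector_field Z ->
  forall x, SU2 x ->
  app Z (fun y => g y (X y) (Y y)) x =
  g x (nabla Z X x) (Y x) + g x (X x) (nabla Z Y x).

Definition levi_civita (g : mat R -> mat R -> mat R -> R)
    (nabla : connection) : Prop :=
  [/\ affine_connection nabla, torsion_free nabla & metric_compatible g nabla].

(* Covariant derivative, along a curve gamma with velocity \sum_i v_i E_i, of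
   the field \sum_j w_j E_j along gamma. *)
Definition covariant_derivative (nabla : connection) (gamma : R -> mat R)
    (v w : 'I_3 -> R -> R) t : mat R :=
  \sum_(j < 3) (derive1 (w j) t)%:C *: E j (gamma t) +
  \sum_(i < 3) \sum_(j < 3) (v i t * w j t)%:C *: nabla (E i) (E j) (gamma t).

(* To be used with D open.  Once the velocity is differentiable, the geodesic
   equation makes gamma smooth. *)
Definition geodesic_on (nabla : connection) (D : set R) (gamma : R -> mat R) :
    Prop :=
  exists v : 'I_3 -> R -> R, forall t, D t ->
    [/\ SU2 (gamma t),
        is_velocity gamma t (\sum_(i < 3) (v i t)%:C *: E i (gamma t)),
        forall i, derivable (v i) t 1 &
        covariant_derivative nabla gamma v v t = 0].

Definition geodesic_from_1 (nabla : connection) (D : set R) (X : mat R)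
    (gamma : R -> mat R) : Prop :=
  [/\ geodesic_on nabla D gamma, gamma 0 = 1 & is_velocity gamma 0 X].

Definition pfrak (c : R) : set (mat R * mat R) :=
  [set z | exists V W : mat R, [/\ mfrak V, kfrak W & z = (V + W, ((1 - c) / 4)%:C *: W)]].

(* The vector of p(c) identified with Xk + Xm, for Xk in k and Xm in m. *)
Definition hat (c : R) (Xk Xm : mat R) : mat R * mat R :=
  (Xm + (4 / (c + 3))%:C *: Xk, - ((c - 1) / (c + 3))%:C *: Xk).

End SU2.

(* Main.v *)
Require Import Defs.
From mathcomp Require Import all_boot all_order all_algebra.
From mathcomp Require Import complex.
From mathcomp Require Import all_classical all_reals all_analysis.
From mathcomp Require Import ring lra.

Set Implicit Arguments.
Unset Strict Implicit.
Unset Printing Implicit Defensive.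

Import Order.TTheory GRing.Theory Num.Theory.
Import numFieldNormedType.Exports.

Local Open Scope ring_scope.
Local Open Scope complex_scope.
Local Open Scope classical_set_scope.

(** The matrices of SU(2) and su(2) are quaternions [quat a b c d], so that the
    exponentials are given by Euler's formula [qexp].  A differentiable
    homomorphism [phi] with velocity [X] at 0 satisfies [phi' = phi X]; comparing
    it with [qexp] gives the uniqueness of one-parameter subgroups, hence the
    values [expGZ], [expKZ] and [expGKZ] of the three exponential maps.
    The curve [gamma] is thereby the product of two one-parameter subgroups,
    called [helix] below.

    Existence and uniqueness of the geodesic come from making the geodesic
    equation explicit.  In the left invariant frame [berger_metric c] is diagonal
    with weights [l, l, l ^+ 2], where [l = 4 / (c + 3)].  Torsion freeness, tested
    on the linear functions [retr M], and metric compatibility give the symmetric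
    part of the connection coefficients by the Koszul formula, and with
    [mu = (c - 1) / (c + 3)] the geodesic equation for the frame velocity
    [(v0, v1, v2)] reads ([covariant_derivativeE])
<<
      v0' = 2 mu v1 v2,    v1' = - 2 mu v0 v2,    v2' = 0.
>>
    So the vertical velocity is a constant [r], and the horizontal velocity
    rotates at the rate [2 mu r].  On the other hand, for [A = Xm + l Xk] and
    [B = mu Xk] the curve [exp (t A) exp (t B)] has frame velocity
    [exp (- t B) A exp (t B) + B].  Since [l + mu = 1] this is the sum of [Xk]
    and of [Xm] conjugated by [exp (t B)], and conjugating by the exponential of
    [t mu r k] rotates the plane of [i] and [j] at the rate [2 mu r]
    ([helix_conj]).  The two velocities agree, which gives existence.  For
    uniqueness, rotating [(v0, v1)] back yields functions with zero derivative on
    the interval of definition ([rotation_ode_unique]), and a curve with the frame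
    velocity of the helix differs from it by a constant factor, equal to 1
    ([helix_unique]). *)

(** * Real-linear functionals on matrices *)

Section RealTrace.
Variable R : realType.
Implicit Types (M A u v : mat R).

(** Every real-linear functional on the matrices has this form.  These functions
    are the tests that reduce statements about matrices, curves and vector
    fields to statements about real functions. *)
Definition retr M A : R := complex.Re (\tr (M * A)).

Lemma retr_linear M (z : R) u v :
  retr M (z%:C *: v + u) = z * retr M v + retr M u.
Proof.
rewrite /retr mulrDr -scalerAr linearD linearZ /=.
by case: (\tr _) (\tr _) => [a b] [a' b'] /=; rewrite mul0r subr0.
Qed.

Lemma retr0 M : retr M 0 = 0.
Proof. by rewrite /retr mulr0 mxtrace0. Qed.

Lemma retrZ M (z : R) v : retr M (z%:C *: v) = z * retr M v.
Proof. by rewrite -[z%:C *: v]addr0 retr_linear retr0 addr0. Qed.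

Lemma retrB M u v : retr M (u - v) = retr M u - retr M v.
Proof.
have := retr_linear M (-1) u v.
by rewrite rmorphN1 scaleN1r mulN1r addrC [RHS]addrC.
Qed.

Lemma retr_rotate A M u : retr (A * M) u = retr M (u * A).
Proof.
by rewrite /retr -mulrA -[A * _]/(A *m _) mxtrace_mulC -[_ *m A]/(_ * _) mulrA.
Qed.

(** Testing against [a delta_qp] reads off the real part of [a] times the entry
    [(p, q)]; the values [a = 1] and [a = i] recover the entry. *)
Lemma retr_inj u v : (forall M, retr M u = retr M v) -> u = v.
Proof.
move=> uv; apply/matrixP => p q.
have entry (a : cplx R) w : \tr (a *: delta_mx q p * w) = a * w p q.
  rewrite -scalerAl linearZ /= /mxtrace (bigD1 q) //= big1 => [|i iq].
    rewrite mxE (bigD1 p) //= big1 => [|j jp]; last first.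
      by rewrite mxE (negbTE jp) andbF mul0r.
    by rewrite mxE !eqxx mul1r !addr0.
  by rewrite mxE big1 // => j _; rewrite mxE (negbTE iq) mul0r.
have := uv (1 *: delta_mx q p); have := uv ('i%C *: delta_mx q p).
rewrite /retr !entry !mul1r mulrC [_ * v p q]mulrC.
by rewrite !ReiNIm => /oppr_inj; case: (u p q) (v p q) => [a b] [a' b'] /= -> ->.
Qed.

End RealTrace.

(** * Limits of matrix-valued functions *)

Section MatrixLimits.
Variables (R : realType) (T : Type) (F : set_system T).
Context {FF : Filter F}.

Lemma cvg_mx2 (f : T -> mat R) (A : mat R) :
  (forall p q, (fun x => f x p q : cplx R) @ F --> (A p q : cplx R)) ->
  f @ F --> A.
Proof.
move=> fA; rewrite [A]matrix_sum_delta.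
rewrite (_ : f = fun x => \sum_p \sum_q f x p q *: delta_mx p q); last first.
  by apply/funext => x; exact: matrix_sum_delta.
apply: cvg_big => [|p _]; first exact: add_continuous.
apply: cvg_big => [|q _]; first exact: add_continuous.
by apply: cvgZr_tmp; exact: fA.
Qed.

Lemma cvg_entry (f : T -> mat R) (A : mat R) p q :
  f @ F --> A -> (fun x => f x p q : cplx R) @ F --> (A p q : cplx R).
Proof.
move=> fA; have := @coord_continuous (cplx R) 2 2 p q A.
by apply: (@cvg_comp _ _ _ f (fun M : mat R => M p q) _ _ _ fA).
Qed.

Lemma cvg_mulmx (f g : T -> mat R) (A B : mat R) :
  f @ F --> A -> g @ F --> B -> (fun x => f x * g x) @ F --> A * B.
Proof.
move=> fA gB; apply: cvg_mx2 => p q; rewrite mxE.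
rewrite (_ : (fun x => _) = fun x => \sum_k f x p k * g x k q); last first.
  by apply/funext => x; rewrite mxE.
apply: cvg_big => [|k _]; first exact: add_continuous.
by apply: cvgM; exact: cvg_entry.
Qed.

Lemma cvg_complexRe (f : T -> cplx R) (z : cplx R) :
  f @ F --> z -> (fun x => complex.Re (f x)) @ F --> complex.Re z.
Proof.
move=> /cvgrPdist_lt fz; apply/cvgrPdist_lt => e e0.
have : 0 < (e%:C : cplx R) by rewrite ltcR.
move=> /fz; apply: filterS => x zfx; rewrite -ltcR; apply: le_lt_trans zfx.
by case: z {fz} (f x) => [a b] [a' b']; exact: (normc_ge_Re ((a - a') +i* (b - b'))).
Qed.

Lemma cvg_realC (f : T -> R) (a : R) :
  f @ F --> a -> (fun x => (f x)%:C : cplx R) @ F --> (a%:C : cplx R).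
Proof.
move=> /cvgrPdist_lt fa; apply/cvgrPdist_lt => e e0.
(* A positive complex number is real. *)
have eE : e = (complex.Re e)%:C by rewrite RRe_real// realE ltW.
have : 0 < complex.Re e by rewrite -ltcR -eE.
move=> /fa; apply: filterS => x; rewrite -ltcR -eE; apply: le_lt_trans.
by rewrite -rmorphB normc_def /= expr0n addr0 sqrtr_sqr.
Qed.

Lemma cvg_retr (M : mat R) (f : T -> mat R) (A : mat R) :
  f @ F --> A -> (fun x => retr M (f x)) @ F --> retr M A.
Proof.
move=> fA; have Mf : (fun x => M * f x) @ F --> M * A.
  by apply: cvg_mulmx fA; exact: cvg_cst.
apply: cvg_complexRe; apply: cvg_big => [|p _]; first exact: add_continuous.
exact: cvg_entry.
Qed.

End MatrixLimits.

(** * Real functions and the equation of a rotation *)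

Section RealFunctions.
Variable R : realType.
Implicit Types (a b s t w : R).

Lemma is_derive_cvgP (f : R -> R) t (d : R) :
  is_derive t 1 f d <-> (fun h : R => h^-1 * (f (t + h) - f t) : R) @ 0^' --> (d : R).
Proof.
rewrite (_ : (fun h : R => _) = fun h : R => h^-1 *: ((f \o shift t) (h *: (1 : R)) - f t)).
  split=> [[fd <-]|fd]; first exact: fd.
  by split; [apply/cvg_ex; exists d|exact: cvg_lim].
by apply/funext => h; rewrite /= [h *: 1]mulr1 [h + t]addrC.
Qed.

(** The mean value theorem on the segment between two points of [D]. *)
Lemma derive0_interval_cst (D : set R) (f : R -> R) :
  is_interval D -> (forall t, D t -> is_derive t 1 f 0) ->
  forall s t, D s -> D t -> f s = f t.
Proof.
move=> Ditv f0; suff le_cst s t : s <= t -> D s -> D t -> f s = f t.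
  by move=> s t Ds Dt; case/orP: (le_total s t) => [st|ts]; [|apply/esym]; apply: le_cst.
move=> st Ds Dt; have Dst r : s <= r <= t -> D r by exact: (Ditv s t).
have [r| |_ _] := @MVT_segment R f (fun=> 0) s t st.
- by rewrite in_itv /= => /andP[sr rt]; apply/f0/Dst; rewrite !ltW.
- apply: derivable_within_continuous => r; rewrite in_itv /= => /Dst/f0[].
  by [].
- by rewrite mul0r => /subr0_eq.
Qed.

Lemma is_derive_mulr w t : is_derive t 1 (fun s => w * s : R) w.
Proof.
by have := is_deriveZ w (is_derive_id t (1 : R)); rewrite [_ *: _]mulr1.
Qed.

Lemma is_derive_cosM w t : is_derive t 1 (fun s => cos (w * s)) (- (w * sin (w * t))).
Proof.
have := is_derive1_comp (is_derive_cos (w * t)) (is_derive_mulr w t).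
by rewrite mulNr mulrC.
Qed.

Lemma is_derive_sinM w t : is_derive t 1 (fun s => sin (w * s)) (w * cos (w * t)).
Proof.
have := is_derive1_comp (is_derive_sin (w * t)) (is_derive_mulr w t).
by rewrite mulrC.
Qed.

Lemma rotation_ode_solution w a b t :
  is_derive t 1 (fun s => a * cos (w * s) + b * sin (w * s))
    (w * (b * cos (w * t) - a * sin (w * t))).
Proof.
have := is_deriveD (is_deriveZ a (is_derive_cosM w t)) (is_deriveZ b (is_derive_sinM w t)).
move=> h; refine (is_derive_eq h _).
rewrite -![_ *: _]/(_ * _); ring.
Qed.

(** Rotating the solution back by the angle [w t] gives functions with zero
    derivative. *)
Lemma rotation_ode_unique (D : set R) (f g : R -> R) w :
  is_interval D -> D 0 ->
  (forall t, D t -> is_derive t 1 f (w * g t)) ->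
  (forall t, D t -> is_derive t 1 g (- (w * f t))) ->
  forall t, D t -> f t = f 0 * cos (w * t) + g 0 * sin (w * t) /\
                   g t = g 0 * cos (w * t) - f 0 * sin (w * t).
Proof.
move=> Ditv D0 df dg t Dt.
pose p s := cos (w * s) * f s - sin (w * s) * g s.
pose q s := sin (w * s) * f s + cos (w * s) * g s.
have p0 s : D s -> is_derive s 1 p 0.
  move=> Ds; have := is_deriveB (is_deriveM (is_derive_cosM w s) (df s Ds))
    (is_deriveM (is_derive_sinM w s) (dg s Ds)).
  move=> h; refine (is_derive_eq h _); rewrite -![_ *: _]/(_ * _); ring.
have q0 s : D s -> is_derive s 1 q 0.
  move=> Ds; have := is_deriveD (is_deriveM (is_derive_sinM w s) (df s Ds))
    (is_deriveM (is_derive_cosM w s) (dg s Ds)).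
  move=> h; refine (is_derive_eq h _); rewrite -![_ *: _]/(_ * _); ring.
have pE : p t = f 0.
  rewrite (derive0_interval_cst Ditv p0 Dt D0) /p mulr0 cos0 sin0; ring.
have qE : q t = g 0.
  rewrite (derive0_interval_cst Ditv q0 Dt D0) /q mulr0 cos0 sin0; ring.
have cs := cos2Dsin2 (w * t).
rewrite -pE -qE /p /q; split.
- transitivity ((cos (w * t) ^+ 2 + sin (w * t) ^+ 2) * f t); last by ring.
  by rewrite cs mul1r.
- transitivity ((cos (w * t) ^+ 2 + sin (w * t) ^+ 2) * g t); last by ring.
  by rewrite cs mul1r.
Qed.

End RealFunctions.

(** * Calculus of velocities *)

Section Velocity.
Variable R : realType.
Implicit Types (f g : R -> mat R) (t : R) (M u v : mat R).

Definition diffquot f t (h : R) : mat R := (h^-1)%:C *: (f (t + h) - f t).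

Lemma is_velocityZ (f : R -> R) t (d : R) M :
  is_derive t 1 f d -> is_velocity (fun s => (f s)%:C *: M) t (d%:C *: M).
Proof.
move=> /is_derive_cvgP fd; rewrite /is_velocity.
rewrite (_ : (fun h => _) = fun h => (h^-1 * (f (t + h) - f t))%:C *: M).
  by apply: cvgZr_tmp; exact: cvg_realC.
by apply/funext => h; rewrite -scalerBl scalerA rmorphM rmorphB.
Qed.

Lemma is_velocityD f g t u v :
  is_velocity f t u -> is_velocity g t v -> is_velocity (fun s => f s + g s) t (u + v).
Proof.
move=> fu gv; rewrite /is_velocity -/(diffquot (fun s => f s + g s) t).
have -> : diffquot (fun s => f s + g s) t = fun h => diffquot f t h + diffquot g t h.
  by apply/funext => h; rewrite -scalerDr /diffquot opprD addrACA.
exact: (cvgD fu gv).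
Qed.

Lemma is_velocity_continuous f t v :
  is_velocity f t v -> (fun h => f (t + h)) @ 0^' --> f t.
Proof.
rewrite /is_velocity => fv.
have h0 : (fun h : R => h%:C : cplx R) @ 0^' --> (0%:C : cplx R).
  by apply: cvg_realC; exact: nbhs_dnbhs.
have := cvgD (cvgZ h0 fv) (cvg_cst (f t)); rewrite scale0r add0r => cv.
apply: cvg_trans (cv _ _ _); apply: near_eq_cvg.
near=> h; have hN0 : h != 0 by near: h; exact: nbhs_dnbhs_neq.
by rewrite fctE /= scalerA -rmorphM divff // scale1r subrK.
Unshelve. all: by end_near. Qed.

Lemma is_velocityM f g t u v :
  is_velocity f t u -> is_velocity g t v ->
  is_velocity (fun s => f s * g s) t (u * g t + f t * v).
Proof.
move=> fu gv; rewrite /is_velocity -/(diffquot (fun s => f s * g s) t).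
have -> : diffquot (fun s => f s * g s) t =
    fun h => diffquot f t h * g (t + h) + f t * diffquot g t h.
  apply/funext => h; rewrite /diffquot.
  by rewrite -scalerAl -scalerAr -scalerDr mulrBl mulrBr addrA subrK.
have fug : (fun h => diffquot f t h * g (t + h)) @ 0^' --> u * g t.
  exact: (cvg_mulmx fu (is_velocity_continuous gv)).
have ftv : (fun h => f t * diffquot g t h) @ 0^' --> f t * v.
  by apply: cvg_mulmx gv; exact: cvg_cst.
exact: (cvgD fug ftv).
Qed.

Lemma is_velocityMl f t M v :
  is_velocity f t v -> is_velocity (fun s => M * f s) t (M * v).
Proof.
move=> fv; rewrite /is_velocity -/(diffquot (fun s => M * f s) t).
have -> : diffquot (fun s => M * f s) t = fun h => M * diffquot f t h.
  by apply/funext => h; rewrite /diffquot -mulrBr -scalerAr.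
by apply: cvg_mulmx fv; exact: cvg_cst.
Qed.

Lemma is_derive_retr f t v M :
  is_velocity f t v -> is_derive t 1 (fun s => retr M (f s)) (retr M v).
Proof.
move=> fv; apply/is_derive_cvgP.
rewrite (_ : (fun h : R => _) = fun h => retr M (diffquot f t h)); last first.
  by apply/funext => h; rewrite /diffquot retrZ retrB.
exact: cvg_retr fv.
Qed.

Lemma is_velocity_unique f t u v :
  is_velocity f t u -> is_velocity f t v -> u = v.
Proof.
move=> fu fv; apply: retr_inj => M.
by have [_ <-] := is_derive_retr M fu; have [_ <-] := is_derive_retr M fv.
Qed.

Lemma velocity0_interval_cst (D : set R) f :
  is_interval D -> (forall t, D t -> is_velocity f t 0) ->
  forall s t, D s -> D t -> f s = f t.
Proof.
move=> Ditv f0 s t Ds Dt; apply: retr_inj => M.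
apply: (@derive0_interval_cst R D (fun r => retr M (f r))) => // r Dr.
by have := is_derive_retr M (f0 r Dr); rewrite retr0.
Qed.

End Velocity.

(** * Matrices as quaternions *)

Section Quaternions.
Variable R : realType.
Implicit Types (a b c d r t : R).

(** The quaternion [a + b i + c j + d k], in the basis of the statement. *)
Definition quat a b c d : mat R :=
  mx2 (a +i* d) ((- c) +i* b) (c +i* b) (a -i* d).

Ltac quat_entries :=
  apply/matrixP; case=> [[|[|//]] ?]; case=> [[|[|//]] ?];
  rewrite /quat /mx2 !(mxE, big_ord_recl, big_ord0) /=;
  apply/eqP; rewrite eq_complex /=; apply/andP; split; apply/eqP => /=.

Lemma bi_quat : bi R = quat 0 1 0 0.
Proof. by rewrite /bi /quat; congr mx2; apply/eqP; rewrite eq_complex /= ?oppr0 ?eqxx. Qed.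

Lemma bj_quat : bj R = quat 0 0 1 0.
Proof. by rewrite /bj /quat; congr mx2; apply/eqP; rewrite eq_complex /= ?oppr0 ?eqxx. Qed.

Lemma bk_quat : bk R = quat 0 0 0 1.
Proof. by rewrite /bk /quat; congr mx2; apply/eqP; rewrite eq_complex /= ?oppr0 ?eqxx. Qed.

Lemma quat1 : quat 1 0 0 0 = 1.
Proof. by quat_entries; ring. Qed.

Lemma quat0 : quat 0 0 0 0 = 0.
Proof. by quat_entries; ring. Qed.

Lemma quatD a b c d a' b' c' d' :
  quat a b c d + quat a' b' c' d' = quat (a + a') (b + b') (c + c') (d + d').
Proof. by quat_entries; ring. Qed.

Lemma quatZ r a b c d :
  r%:C *: quat a b c d = quat (r * a) (r * b) (r * c) (r * d).
Proof. by quat_entries; ring. Qed.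

Lemma quatN a b c d : - quat a b c d = quat (- a) (- b) (- c) (- d).
Proof. by quat_entries; ring. Qed.

Lemma quatM a b c d a' b' c' d' :
  quat a b c d * quat a' b' c' d' =
  quat (a * a' - b * b' - c * c' - d * d') (a * b' + b * a' + c * d' - d * c')
       (a * c' - b * d' + c * a' + d * b') (a * d' + b * c' - c * b' + d * a').
Proof. by quat_entries; ring. Qed.

Lemma quat_adjoint a b c d :
  (quat a b c d)^t*%sesqui = quat a (- b) (- c) (- d).
Proof. by quat_entries; ring. Qed.

Lemma det_quat a b c d :
  \det (quat a b c d) = (a ^+ 2 + b ^+ 2 + c ^+ 2 + d ^+ 2)%:C.
Proof.
rewrite (expand_det_row _ ord0) !big_ord_recl big_ord0 /cofactor !det_mx11.
rewrite /quat /mx2 !mxE /=.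
by apply/eqP; rewrite eq_complex /=; apply/andP; split; apply/eqP => /=; ring.
Qed.

Lemma quat_inj a b c d a' b' c' d' :
  quat a b c d = quat a' b' c' d' -> [/\ a = a', b = b', c = c' & d = d'].
Proof.
move=> /matrixP qq'; have := qq' ord0 ord0; have := qq' (lift ord0 ord0) ord0.
by rewrite !mxE /= => -[-> ->] [-> ->].
Qed.

Lemma quat_SU2 a b c d :
  a ^+ 2 + b ^+ 2 + c ^+ 2 + d ^+ 2 = 1 -> SU2 (quat a b c d).
Proof.
move=> q1; split; last by rewrite det_quat q1.
apply/unitarymxP; rewrite quat_adjoint.
rewrite -[_ *m _]/(quat a b c d * quat a (- b) (- c) (- d)) quatM.
rewrite -[RHS]/(1 : mat R) -quat1; congr quat; last 3 first; try by ring.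
by rewrite -q1; ring.
Qed.

Lemma mx2_eta (A : mat R) (i0 := ord0 : 'I_2) (i1 := lift ord0 ord0 : 'I_2) :
  A = mx2 (A i0 i0) (A i0 i1) (A i1 i0) (A i1 i1).
Proof.
apply/matrixP; case=> [[|[|//]] ?]; case=> [[|[|//]] ?]; rewrite /mx2 !mxE /=;
by congr (A _ _); apply: val_inj.
Qed.

Lemma su2_quat (A : mat R) : su2 A -> exists b c d, A = quat 0 b c d.
Proof.
move=> [/matrixP AN trA]; pose i1 : 'I_2 := lift ord0 ord0.
have := AN ord0 ord0; have := AN i1 ord0; have := mx2_eta A.
move: trA; rewrite /mxtrace !(big_ord_recl, big_ord0) !mxE -/i1 addr0 /=.
move: (A ord0 ord0) (A i1 i1) (A ord0 i1) (A i1 ord0).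
move=> [z1 z2] [w1 w2] [x1 x2] [y1 y2] zw ->.
have [zw1 zw2] := (congr1 (@complex.Re R) zw, congr1 (@complex.Im R) zw).
move=> xy zz.
have [xy1 xy2] := (congr1 (@complex.Re R) xy, congr1 (@complex.Im R) xy).
have [zz1 zz2] := (congr1 (@complex.Re R) zz, congr1 (@complex.Im R) zz).
move: zw1 zw2 xy1 xy2 zz1 zz2 => /= zw1 zw2 xy1 xy2 zz1 zz2.
exists y2, y1, z2; rewrite /quat; congr mx2; apply/eqP; rewrite eq_complex /=;
by apply/andP; split; apply/eqP; lra.
Qed.

End Quaternions.

(** * Exponentials in SU(2), K and their product *)

Section Exponential.
Variable R : realType.
Implicit Types (a b c d r s t : R).

Definition qnorm b c d : R := Num.sqrt (b ^+ 2 + c ^+ 2 + d ^+ 2).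

Lemma qnorm_sqr b c d : qnorm b c d ^+ 2 = b ^+ 2 + c ^+ 2 + d ^+ 2.
Proof. by rewrite sqr_sqrtr // !addr_ge0 ?sqr_ge0. Qed.

(** Euler's formula [exp (t u) = cos (n t) + sin (n t) / n * u] for an imaginary
    quaternion [u] of norm [n]; for [n = 0] the convention [_ / 0 = 0] gives 1. *)
Definition qexp b c d t : mat R :=
  let n := qnorm b c d in let s := sin (n * t) / n in
  quat (cos (n * t)) (s * b) (s * c) (s * d).

Lemma qexp0 b c d : qexp b c d 0 = 1.
Proof. by rewrite /qexp mulr0 sin0 cos0 !mul0r quat1. Qed.

Lemma qexpN b c d t : qexp (- b) (- c) (- d) t = qexp b c d (- t).
Proof.
by rewrite /qexp /qnorm !sqrrN !mulrN sinN cosN !mulNr.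
Qed.

(** The norm is multiplied by [`|r|] and not by [r], but Euler's formula is even
    in the norm. *)
Lemma qexpZ r b c d t : qexp (r * b) (r * c) (r * d) t = qexp b c d (r * t).
Proof.
have [->|rN0] := eqVneq r 0.
  rewrite !mul0r qexp0 /qexp !mulr0 /qnorm !expr0n /= !addr0 sqrtr0.
  by rewrite mul0r cos0 quat1.
have nE : qnorm (r * b) (r * c) (r * d) = `|r| * qnorm b c d.
  by rewrite /qnorm !exprMn -!mulrDr sqrtrM ?sqr_ge0 // sqrtr_sqr.
rewrite /qexp nE; set n := qnorm b c d.
have -> : cos (`|r| * n * t) = cos (n * (r * t)).
  by case: (ger0P r) => _; rewrite ?mulNr ?cosN; congr cos; ring.
have -> : sin (`|r| * n * t) / (`|r| * n) = sin (n * (r * t)) / n / r.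
  have -> : n * (r * t) = r * n * t by ring.
  rewrite invfM -[RHS]mulrA [n^-1 / r]mulrC.
  by case: (ger0P r) => _; rewrite // invrN !mulNr sinN mulrNN.
by congr quat; rewrite mulrA mulfVK.
Qed.

Lemma qexp_norm1 b c d t : let n := qnorm b c d in
  (cos (n * t)) ^+ 2 + (sin (n * t) / n) ^+ 2 * n ^+ 2 = 1.
Proof.
move=> n; rewrite -[RHS](cos2Dsin2 (n * t)); congr (_ + _).
have [->|n0] := eqVneq n 0; first by rewrite mul0r sin0 mul0r expr0n mul0r.
by rewrite -exprMn divfK.
Qed.

Lemma qexp_SU2 b c d t : SU2 (qexp b c d t).
Proof.
apply: quat_SU2; rewrite -[RHS](qexp_norm1 b c d t) /= qnorm_sqr; ring.
Qed.

Lemma qexpD b c d s t : qexp b c d (s + t) = qexp b c d s * qexp b c d t.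
Proof.
rewrite /qexp quatM; set n := qnorm b c d; rewrite !mulrDr sinD cosD.
have sqn := qnorm_sqr b c d; rewrite -/n in sqn.
have [n0|n0] := eqVneq n 0.
  by rewrite n0 !mul0r sin0 cos0 !mul0r; congr quat; ring.
congr quat; [|by field|by field|by field].
have -> : sin (n * s) * sin (n * t) =
    sin (n * s) / n * (sin (n * t) / n) * (b ^+ 2 + c ^+ 2 + d ^+ 2).
  by rewrite -sqn; field.
by ring.
Qed.

Lemma qexpVK b c d t : qexp (- b) (- c) (- d) t * qexp b c d t = 1.
Proof. by rewrite qexpN -qexpD addNr qexp0. Qed.

Lemma qexpC b c d t : qexp b c d t * quat 0 b c d = quat 0 b c d * qexp b c d t.
Proof. by rewrite /qexp !quatM; congr quat; ring. Qed.

Lemma qexp_velocity b c d t :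
  is_velocity (qexp b c d) t (qexp b c d t * quat 0 b c d).
Proof.
set n := qnorm b c d; have sqn : n ^+ 2 = _ := qnorm_sqr b c d.
have dc := is_derive_cosM n t.
have ds : is_derive t 1 (fun s => sin (n * s) / n) (cos (n * t) * n / n).
  have := is_deriveZ n^-1 (is_derive_sinM n t).
  rewrite [_ *: (_ * _)]mulrC [n * cos _]mulrC; congr is_derive.
  by apply/funext => s; exact: mulrC.
have := is_velocityD (@is_velocityZ _ _ _ _ (quat 1 0 0 0) dc)
  (@is_velocityZ _ _ _ _ (quat 0 b c d) ds).
rewrite !quatZ quatD /qexp quatM -/n; congr is_velocity.
  by apply/funext => s; rewrite !quatZ quatD; congr quat; ring.
have [n0|n0] := eqVneq n 0; last first.
  congr quat; last 3 first; try by field.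
  (* The real part is where the norm enters: [u * u = - n ^+ 2]. *)
  rewrite mulr0 addr0 mulr1 mulr0 sub0r.
  have -> : - (n * sin (n * t)) = - (sin (n * t) / n * n ^+ 2) by field.
  by rewrite sqn; ring.
(* If [n = 0] then [u = 0] and both sides vanish. *)
have [b0 c0 d0] : [/\ b = 0, c = 0 & d = 0].
  move: sqn; rewrite n0 expr0n /= => /esym/eqP.
  rewrite !paddr_eq0 ?addr_ge0 ?sqr_ge0 // !sqrf_eq0.
  by move=> /andP[/andP[/eqP-> /eqP->] /eqP->].
by rewrite b0 c0 d0 n0 !mul0r sin0; congr quat; ring.
Qed.

Lemma qexp_velocity0 b c d : is_velocity (qexp b c d) 0 (quat 0 b c d).
Proof. by have := @qexp_velocity b c d 0; rewrite qexp0 mul1r. Qed.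

Local Notation one_parameter_subgroupM := (@one_parameter_subgroup R (mat R) *%R).

Lemma qexp_one_parameter b c d :
  one_parameter_subgroupM (@SU2 R) (quat 0 b c d) (qexp b c d).
Proof.
split; [exact: qexp_SU2|exact: qexpD|exact: qexp_velocity0].
Qed.

(** A differentiable homomorphism [phi] satisfies [phi' = phi X], because its
    difference quotient at [t] is [phi t] times the one at 0. *)
Lemma one_parameter_velocity (H : set (mat R)) X (phi : R -> mat R) t :
  one_parameter_subgroupM H X phi -> is_velocity phi t (phi t * X).
Proof.
move=> [_ phiD phi0]; rewrite /is_velocity -/(diffquot phi t).
have -> : diffquot phi t = fun h => phi t * diffquot phi 0 h.
  apply/funext => h; rewrite /diffquot add0r phiD -scalerAr mulrBr.
  by rewrite -[phi t * phi 0]phiD addr0.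
by apply: cvg_mulmx phi0; exact: cvg_cst.
Qed.

Lemma SU2_unit (x : mat R) : SU2 x -> x \is a GRing.unit.
Proof. by move=> [/unitarymx_unit]. Qed.

Lemma SU2M (x y : mat R) : SU2 x -> SU2 y -> SU2 (x * y).
Proof.
move=> [ux dx] [uy dy]; split; first exact: mul_unitarymx.
by rewrite det_mulmx dx dy mulr1.
Qed.

(** [phi t * exp (- t u)] has zero velocity, so it keeps its value 1 at 0. *)
Lemma one_parameter_subgroup_unique (H : set (mat R)) b c d phi :
  H `<=` @SU2 R -> one_parameter_subgroupM H (quat 0 b c d) phi ->
  phi = qexp b c d.
Proof.
move=> HG sub; have [Hphi phiD _] := sub.
have phi1 : phi 0 = 1.
  apply: (mulrI (SU2_unit (HG _ (Hphi 0)))).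
  by rewrite mulr1 -phiD addr0.
pose q := qexp (- b) (- c) (- d).
have cst t : phi t * q t = 1.
  have itvT : is_interval [set: R] by [].
  have -> : 1 = phi 0 * q 0 by rewrite phi1 /q qexp0 mulr1.
  apply: (velocity0_interval_cst itvT (f := fun t => phi t * q t)) => // s _.
  rewrite /q; have := is_velocityM (@one_parameter_velocity H _ phi s sub)
    (@qexp_velocity (- b) (- c) (- d) s).
  rewrite qexpC.
  have -> : quat 0 (- b) (- c) (- d) = - quat 0 b c d by rewrite quatN oppr0.
  by rewrite mulNr mulrN mulrA subrr.
by apply/funext => t; rewrite -[LHS]mulr1 -(qexpVK b c d t) mulrA cst mul1r.
Qed.

Lemma lie_exp_quat (H : set (mat R)) b c d :
  H `<=` @SU2 R -> (forall t, H (qexp b c d t)) ->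
  @lie_exp R (mat R) *%R H (quat 0 b c d) = qexp b c d 1.
Proof.
move=> HG Hq; rewrite /lie_exp; congr (_ 1); apply: xget_unique.
  by have [_ D V] := qexp_one_parameter b c d; split.
by move=> phi; exact: one_parameter_subgroup_unique.
Qed.

Lemma expGZ t b c d : expG (t%:C *: quat 0 b c d) = qexp b c d t.
Proof.
rewrite quatZ mulr0 /expG lie_exp_quat ?qexpZ ?mulr1 // => s.
exact: qexp_SU2.
Qed.

Lemma qexpK d t : K (qexp 0 0 d t).
Proof.
exists (t * d) => //; rewrite bk_quat expGZ.
by rewrite mulrC -qexpZ mulr0 mulr1.
Qed.

Lemma K_subset_SU2 : @K R `<=` @SU2 R.
Proof. by move=> _ [s _ <-]; rewrite bk_quat expGZ; exact: qexp_SU2. Qed.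

Lemma expKZ t d : expK (t%:C *: quat 0 0 0 d) = qexp 0 0 d t.
Proof.
have qE s : qexp (t * 0) (t * 0) (t * d) s = qexp 0 0 d (t * s) := qexpZ t 0 0 d s.
rewrite quatZ mulr0 /expK lie_exp_quat; [|exact: K_subset_SU2|move=> s].
  by have := qE 1; rewrite !mulr0 mulr1.
exact: qexpK.
Qed.

Lemma is_velocity_fst (phi : R -> mat R * mat R) t (v : mat R * mat R) :
  @is_velocity R (mat R * mat R)%type phi t v -> is_velocity (fst \o phi) t v.1.
Proof.
rewrite /is_velocity => phiv.
have fstv : (@fst (mat R) (mat R)) @ v --> v.1 by case: v {phiv} => a b; exact: cvg_fst.
exact: (cvg_comp _ _ phiv fstv).
Qed.

Lemma is_velocity_snd (phi : R -> mat R * mat R) t (v : mat R * mat R) :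
  @is_velocity R (mat R * mat R)%type phi t v -> is_velocity (snd \o phi) t v.2.
Proof.
rewrite /is_velocity => phiv.
have sndv : (@snd (mat R) (mat R)) @ v --> v.2 by case: v {phiv} => a b; exact: cvg_snd.
exact: (cvg_comp _ _ phiv sndv).
Qed.

(** The one-parameter subgroups of the product are the pairs of one-parameter
    subgroups of the factors. *)
Lemma expGKZ t b c d d' :
  expGK (t%:C *: (quat 0 b c d, quat 0 0 0 d')) = (qexp b c d t, qexp 0 0 d' t).
Proof.
have -> : t%:C *: (quat 0 b c d, quat 0 0 0 d') =
    (quat 0 (t * b) (t * c) (t * d), quat 0 (t * 0) (t * 0) (t * d')) :> mat R * mat R.
  by rewrite -[LHS]/(t%:C *: quat 0 b c d, t%:C *: quat 0 0 0 d') !quatZ !mulr0.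
rewrite /expGK /lie_exp.
rewrite (_ : xget _ _ = fun s => (qexp (t * b) (t * c) (t * d) s,
                                  qexp (t * 0) (t * 0) (t * d') s)).
  by rewrite !qexpZ !mulr1.
apply: xget_unique.
  have [G1 D1 V1] := qexp_one_parameter (t * b) (t * c) (t * d).
  have [_ D2 V2] := qexp_one_parameter (t * 0) (t * 0) (t * d').
  split=> [s|r s|].
  - by split=> //=; rewrite !mulr0; exact: qexpK.
  - by rewrite D1 D2.
  - exact: (cvg_pair V1 V2).
move=> phi [Hphi phiD phiV].
have phi1 : fst \o phi = qexp (t * b) (t * c) (t * d).
  apply: (@one_parameter_subgroup_unique (@SU2 R)) => //; split.
  - by move=> s; have [] := Hphi s.
  - by move=> r s; rewrite /= phiD.
  - exact: (is_velocity_fst phiV).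
have phi2 : snd \o phi = qexp (t * 0) (t * 0) (t * d').
  apply: (one_parameter_subgroup_unique K_subset_SU2); split.
  - by move=> s; have [] := Hphi s.
  - by move=> r s; rewrite /= phiD.
  - exact: (is_velocity_snd phiV).
by apply/funext => s; rewrite -phi1 -phi2 /=; case: (phi s).
Qed.

End Exponential.

(** * Quadratic forms *)

(** A quadratic form only sees the symmetric part of its matrix. *)
Lemma quadratic_sum_sym (R : numDomainType) n (u : 'I_n -> R) (a b : 'I_n -> 'I_n -> R) :
  (forall i j, a i j + a j i = b i j + b j i) ->
  \sum_i \sum_j u i * u j * a i j = \sum_i \sum_j u i * u j * b i j.
Proof.
move=> ab; have double (f : 'I_n -> 'I_n -> R) :
    2 * (\sum_i \sum_j u i * u j * f i j) =
    \sum_i \sum_j u i * u j * (f i j + f j i).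
  rewrite mulr_natl mulr2n [X in _ + X]exchange_big -big_split.
  apply: eq_bigr => i _; rewrite -big_split; apply: eq_bigr => j _ /=.
  by rewrite mulrDr [u j * u i]mulrC.
apply: (mulfI (_ : 2 != 0)); first by rewrite pnatr_eq0.
by rewrite !double; do 2!(apply: eq_bigr => ? _); rewrite ab.
Qed.

(** * Left invariant vector fields *)

Local Notation o0 := (ord0 : 'I_3).
Local Notation o1 := (lift ord0 ord0 : 'I_3).
Local Notation o2 := (lift ord0 (lift ord0 ord0) : 'I_3).

Section LeftInvariantGeometry.
Variable R : realType.
Implicit Types (x A M : mat R) (u : 'I_3 -> R) (i j k : 'I_3).

Definition basis i : mat R := tnth [tuple bi R; bj R; bk R] i.

Lemma basis_quat i :
  basis i = quat 0 (i == o0)%:R (i == o1)%:R (i == o2)%:R.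
Proof.
rewrite /basis; case: i => [[|[|[|//]]] ?]; rewrite (tnth_nth 0) /=.
- exact: bi_quat.
- exact: bj_quat.
- exact: bk_quat.
Qed.

Lemma basis_comb u : \sum_i (u i)%:C *: basis i = quat 0 (u o0) (u o1) (u o2).
Proof.
rewrite !big_ord_recl big_ord0 !basis_quat !quatZ addr0 !quatD /=.
by congr quat; ring.
Qed.

Lemma frame_comb u x :
  \sum_(i < 3) (u i)%:C *: E i x = x * quat 0 (u o0) (u o1) (u o2).
Proof.
rewrite -basis_comb mulr_sumr; apply: eq_bigr => i _.
by rewrite scalerAr.
Qed.

Lemma inner1_quat a b c d a' b' c' d' :
  inner1 (quat a b c d) (quat a' b' c' d') =
  b * b' + c * c' + d * d' - a * a' :> R.
Proof.
rewrite /inner1 -[_ *m _]/(quat a b c d * quat a' b' c' d') quatM.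
rewrite /mxtrace !big_ord_recl big_ord0 /quat /mx2 !mxE /=.
by field.
Qed.

Lemma lieD_quat b c d (f : mat R -> R) x :
  lieD (quat 0 b c d) f x = derive1 (fun h => f (x * qexp b c d h)) 0.
Proof.
by rewrite /lieD; congr (derive1 _ 0); apply/funext => h; rewrite expGZ.
Qed.

Lemma is_derive_retr_qexp M b c d x :
  is_derive (0 : R) 1 (fun h => retr M (x * qexp b c d h)) (retr M (x * quat 0 b c d)).
Proof. exact/is_derive_retr/is_velocityMl/qexp_velocity0. Qed.

Lemma lieD_retr M b c d : lieD (quat 0 b c d) (retr M) = retr (quat 0 b c d * M).
Proof.
apply/funext => x; rewrite lieD_quat derive1E.
have [_ ->] := is_derive_retr_qexp M b c d x.
exact/esym/retr_rotate.
Qed.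

Lemma continuous_retr M : continuous (retr M).
Proof.
move=> x; apply: (@cvg_retr _ _ (nbhs x) _ M id); exact: cvg_id.
Qed.

(** The functions [retr M] are closed under derivation by left invariant fields,
    so continuity gives all orders of differentiability. *)
Lemma smooth_retr M : smooth (retr M).
Proof.
move=> n; elim: n M => [|n IH] M; split=> //;
  try by apply: continuous_subspaceT; exact: continuous_retr.
move=> _ /su2_quat[b [c [d ->]]]; split=> [x _|]; last by rewrite lieD_retr.
under [X in derivable X]funext => h do rewrite expGZ.
by have [] := is_derive_retr_qexp M b c d x.
Qed.

Lemma smooth_cst (r : R) : smooth (fun=> r : R).
Proof.
move=> n; have cr s : {within @SU2 R, continuous (fun=> s : R)}.
  by apply: continuous_subspaceT; exact: cst_continuous.
elim: n r => [|n IH] r; (split; first exact: cr) => // A _.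
split=> [x _|]; first by have [] := is_derive_cst r (0 : R) (1 : R).
have -> : lieD A (fun=> r) = fun=> 0; last exact: IH.
by apply/funext => x; rewrite /lieD derive1_cst.
Qed.

Lemma vector_fieldE i : vector_field (E i : mat R -> mat R).
Proof.
exists (fun j _ => (j == i)%:R); split=> [j|x _]; first exact: smooth_cst.
rewrite (bigD1 i) //= eqxx big1 ?addr0 ?scale1r // => j /negbTE->.
by rewrite scale0r.
Qed.

Lemma tderivM (f : mat R -> R) x A : SU2 x -> tderiv f x (x * A) = lieD A f x.
Proof. by move=> /SU2_unit ux; rewrite /tderiv mulKr. Qed.

Definition coord i A : R := inner1 (basis i) A.

Lemma coord_quat i a b c d :
  coord i (quat a b c d) = (i == o0)%:R * b + (i == o1)%:R * c + (i == o2)%:R * d.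
Proof. by rewrite /coord basis_quat inner1_quat mul0r subr0. Qed.

Lemma coord_tangent u x i :
  SU2 x -> coord i (x^-1 * \sum_(j < 3) (u j)%:C *: E j x) = u i.
Proof.
move=> /SU2_unit ux; rewrite frame_comb mulKr // coord_quat.
case: i => [[|[|[|//]]] ?] /=; rewrite !(mul0r, mul1r, add0r, addr0);
by congr u; apply: val_inj.
Qed.

Lemma coordB i A (B : mat R) : coord i (A - B) = coord i A - coord i B.
Proof.
have coord_retr A' : coord i A' = - 2^-1 * retr (basis i) A' by [].
by rewrite !coord_retr retrB mulrBr.
Qed.

Lemma inner1C A (B : mat R) : inner1 A B = inner1 B A.
Proof. by rewrite /inner1 mxtrace_mulC. Qed.

Lemma coord_sym i A : inner1 A (basis i) = coord i A.
Proof. exact: inner1C. Qed.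

Lemma E_tangent i x : SU2 x -> x^-1 * E i x = basis i.
Proof. by move=> /SU2_unit ux; rewrite mulKr. Qed.

Lemma app_frame i (f : mat R -> R) x : SU2 x -> app (E i) f x = lieD (basis i) f x.
Proof. exact: tderivM. Qed.

(** * The Levi-Civita connection in the left invariant frame *)

Section Koszul.
Variables (c : R) (nabla : connection R).
Hypothesis hnabla : levi_civita (berger_metric c) nabla.
Hypothesis hc : -3 < c.

(** The squared lengths of the frame for [berger_metric c]: writing
    [l = 4 / (c + 3)], the vertical one is [l * (1 - (c - 1) / (c + 3)) = l ^+ 2]. *)
Definition weight i : R := (4 / (c + 3)) ^+ (i == o2).+1.

Lemma addc3_neq0 : c + 3 != 0.
Proof. by rewrite gt_eqF //; move: hc; lra. Qed.

Lemma weight_neq0 i : weight i != 0.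
Proof. by rewrite expf_neq0 // mulf_neq0 ?invr_eq0 ?addc3_neq0 ?pnatr_eq0. Qed.

Lemma berger_metric_frame x (A : mat R) j : SU2 x ->
  berger_metric c x A (E j x) = weight j * coord j (x^-1 * A).
Proof.
move=> Gx; rewrite /berger_metric /eta1 /g1 !E_tangent // coord_sym.
have -> : inord 2 = o2 by apply: val_inj; rewrite /= inordK.
rewrite -![inner1 (basis o2) _]/(coord o2 _) basis_quat coord_quat /weight.
have c3 := addc3_neq0.
by case: j => [[|[|[|//]]] ?] /=; field.
Qed.

Lemma berger_metricC x (A B : mat R) : berger_metric c x A B = berger_metric c x B A.
Proof.
rewrite /berger_metric; have -> : g1 x A B = g1 x B A by exact: inner1C.
by set h := g1 x B A; set p := eta1 x A; set q := eta1 x B; ring.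
Qed.

Definition christoffel x i j k : R := coord k (x^-1 * nabla (E i) (E j) x).

Lemma nabla_frame x i j : SU2 x ->
  nabla (E i) (E j) x = \sum_(k < 3) (christoffel x i j k)%:C *: E k x.
Proof.
move=> Gx; have [[vf _ _ _] _ _] := hnabla.
have [a [_ aE]] := vf _ _ (vector_fieldE i) (vector_fieldE j).
rewrite {1}aE //; apply: eq_bigr => k _.
by rewrite /christoffel aE // coord_tangent.
Qed.

Definition bracket i j k := coord k (basis i * basis j - basis j * basis i).

(** Torsion freeness is tested on the linear functions [retr M]: on them the
    derivation [E_i E_j - E_j E_i] is right multiplication by a commutator. *)
Lemma torsion_frame x i j k : SU2 x ->
  christoffel x i j k - christoffel x j i k = bracket i j k.
Proof.
move=> Gx; have [_ tors _] := hnabla.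
rewrite /christoffel /bracket -coordB -mulrBr; congr coord.
rewrite -[RHS](mulKr (SU2_unit Gx)); congr (_ * _); apply: retr_inj => M.
have appapp p q : app (E p) (app (E q) (retr M)) x = retr M (x * (basis p * basis q)).
  rewrite app_frame // [X in lieD X]basis_quat lieD_quat.
  rewrite (_ : (fun h : R => _) = fun h => retr (basis q * M)
    (x * qexp (p == o0)%:R (p == o1)%:R (p == o2)%:R h)).
    rewrite derive1E; have [_ ->] := is_derive_retr_qexp (basis q * M)
      (p == o0)%:R (p == o1)%:R (p == o2)%:R x.
    by rewrite -basis_quat retr_rotate mulrA.
  apply/funext => h; rewrite app_frame ?basis_quat ?lieD_retr //.
  by apply: SU2M => //; exact: qexp_SU2.
have := tors _ _ _ (vector_fieldE i) (vector_fieldE j) (smooth_retr M) _ Gx.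
have nabla_quat p q : nabla (E p) (E q) x =
    x * quat 0 (christoffel x p q o0) (christoffel x p q o1) (christoffel x p q o2).
  by rewrite nabla_frame // frame_comb.
rewrite !appapp (nabla_quat i j) (nabla_quat j i).
rewrite -mulrBr quatN quatD subrr.
rewrite (tderivM _ _ Gx) lieD_retr retr_rotate => E; apply: (etrans E).
by rewrite -retrB -mulrBr.
Qed.

(** The frame has constant inner products, so metric compatibility makes the
    lowered coefficients skew in the last two indices. *)
Lemma compat_frame x i j k : SU2 x ->
  weight j * christoffel x k i j + weight i * christoffel x k j i = 0.
Proof.
move=> Gx; have [_ _ compat] := hnabla.
have := compat _ _ _ (vector_fieldE i) (vector_fieldE j) (vector_fieldE k) _ Gx.
rewrite [X in _ = _ + X]berger_metricC !berger_metric_frame // => <-.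
rewrite app_frame // basis_quat lieD_quat.
rewrite (_ : (fun h => _) = fun=> weight j * coord j (basis i)).
  by rewrite derive1_cst.
apply/funext => h; have Gxh : SU2 (x * qexp (k == o0)%:R (k == o1)%:R (k == o2)%:R h).
  by apply: SU2M => //; exact: qexp_SU2.
by rewrite berger_metric_frame // E_tangent.
Qed.

(** Koszul formula, symmetrized in the first two indices: this is the part of
    the connection that enters the geodesic equation. *)
Lemma koszul x i j k : SU2 x ->
  weight k * (christoffel x i j k + christoffel x j i k) =
  - (weight j * bracket i k j + weight i * bracket j k i).
Proof.
move=> Gx; rewrite -!(torsion_frame _ _ _ Gx).
move: (compat_frame j k i Gx) (compat_frame i k j Gx) (compat_frame i j k Gx).
move: (weight i) (weight j) (weight k) => li lj lk.
move: (christoffel x i j k) (christoffel x j i k) (christoffel x i k j)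
  (christoffel x k i j) (christoffel x j k i) (christoffel x k j i) => a a' b d b' d'.
by move=> ijk jik kij; lra.
Qed.

(** The quadratic part of the Euler equations of the left invariant metric. *)
Lemma spray x u k : SU2 x ->
  weight k * \sum_i \sum_j u i * u j * christoffel x i j k =
  - \sum_i \sum_j u i * u j * weight j * bracket i k j.
Proof.
move=> Gx; rewrite mulr_sumr -sumrN.
under eq_bigr do rewrite mulr_sumr; under [RHS]eq_bigr do rewrite -sumrN.
under eq_bigr => i _ do under eq_bigr => j _ do rewrite mulrCA.
under [RHS]eq_bigr => i _ do under eq_bigr => j _ do
  rewrite -[u i * u j * _ * _]mulrA -mulrN.
apply: quadratic_sum_sym => i j.
by rewrite -mulrDr koszul // opprD.
Qed.

Lemma bracketE :
  bracket = fun i j k =>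
    2 * (((i == o1) && (j == o2))%:R - ((i == o2) && (j == o1))%:R) * (k == o0)%:R
  + 2 * (((i == o2) && (j == o0))%:R - ((i == o0) && (j == o2))%:R) * (k == o1)%:R
  + 2 * (((i == o0) && (j == o1))%:R - ((i == o1) && (j == o0))%:R) * (k == o2)%:R.
Proof.
apply/funext => i; apply/funext => j; apply/funext => k.
rewrite /bracket !basis_quat !quatM quatN quatD coord_quat.
by case: i j k => [[|[|[|//]]] ?] [[|[|[|//]]] ?] [[|[|[|//]]] ?] /=; ring.
Qed.

Lemma sum33E (f : 'I_3 -> 'I_3 -> R) :
  \sum_i \sum_j f i j = f o0 o0 + f o0 o1 + f o0 o2 +
    (f o1 o0 + f o1 o1 + f o1 o2) + (f o2 o0 + f o2 o1 + f o2 o2).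
Proof.
have sum3E (g : 'I_3 -> R) : \sum_i g i = g o0 + g o1 + g o2.
  by rewrite !big_ord_recl big_ord0 addr0 addrA.
by rewrite sum3E (sum3E (f o0)) (sum3E (f o1)) (sum3E (f o2)).
Qed.

(** The horizontal part of the velocity is turned at the rate [2 * mu * u o2],
    and the vertical part feels no force. *)
Lemma spray_coords x u : SU2 x ->
  let S k := \sum_i \sum_j u i * u j * christoffel x i j k in
  let mu := (c - 1) / (c + 3) in
  [/\ S o0 = - (2 * mu * u o1 * u o2), S o1 = 2 * mu * u o0 * u o2 & S o2 = 0].
Proof.
move=> Gx S mu; have c3 := addc3_neq0.
have SE k (r : R) :
    - (\sum_i \sum_j u i * u j * weight j * bracket i k j) = weight k * r ->
    S k = r.
  by rewrite -(@spray x) // => /(mulfI (weight_neq0 k)).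
split.
- by apply: (SE o0); rewrite sum33E bracketE /weight /= /mu; field.
- by apply: (SE o1); rewrite sum33E bracketE /weight /= /mu; field.
- by apply: (SE o2); rewrite sum33E bracketE /weight /= /mu; field.
Qed.

Lemma covariant_derivativeE (gamma : R -> mat R) (v : 'I_3 -> R -> R) (t : R) :
  SU2 (gamma t) -> let mu := (c - 1) / (c + 3) in
  covariant_derivative nabla gamma v v t =
  gamma t * quat 0 (derive1 (v o0) t - 2 * mu * v o1 t * v o2 t)
                   (derive1 (v o1) t + 2 * mu * v o0 t * v o2 t)
                   (derive1 (v o2) t).
Proof.
move=> Gt mu; set x := gamma t in Gt *.
have [S0 S1 S2] := spray_coords (fun i => v i t) Gt.
pose S k := \sum_i \sum_j v i t * v j t * christoffel x i j k.
have -> : covariant_derivative nabla gamma v v t =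
    \sum_(k < 3) (derive1 (v k) t + S k)%:C *: E k x.
  rewrite /covariant_derivative -/x.
  under [RHS]eq_bigr do rewrite rmorphD scalerDl; rewrite big_split; congr (_ + _).
  transitivity (\sum_(i < 3) \sum_(j < 3) \sum_(k < 3)
      (v i t * v j t * christoffel x i j k)%:C *: E k x).
    apply: eq_bigr => i _; apply: eq_bigr => j _.
    rewrite (nabla_frame i j Gt) scaler_sumr; apply: eq_bigr => k _.
    by rewrite scalerA -rmorphM.
  transitivity (\sum_(i < 3) \sum_(k < 3) \sum_(j < 3)
      (v i t * v j t * christoffel x i j k)%:C *: E k x).
    by apply: eq_bigr => i _; exact: exchange_big.
  rewrite exchange_big; apply: eq_bigr => k _.
  rewrite /S rmorph_sum scaler_suml; apply: eq_bigr => i _.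
  by rewrite rmorph_sum scaler_suml.
rewrite frame_comb; congr (_ * quat 0 _ _ _).
- exact: (congr1 (fun s => derive1 (v o0) t + s) S0).
- exact: (congr1 (fun s => derive1 (v o1) t + s) S1).
- by rewrite -[RHS]addr0; exact: (congr1 (fun s => derive1 (v o2) t + s) S2).
Qed.

End Koszul.

End LeftInvariantGeometry.

(** * Products of two one-parameter subgroups *)

Section Helix.
Variable R : realType.
Variables a b e d : R.
Implicit Types (t : R).

(** All geodesics through 1 of all the Berger metrics have this form, with a
    vertical second factor. *)
Definition helix t : mat R := qexp a b e t * qexp 0 0 d t.
Definition helix_inv t : mat R := qexp 0 0 (- d) t * qexp (- a) (- b) (- e) t.

(** This is [helix^-1 * helix'], the velocity in the left invariant frame. *)
Definition helix_velocity t : mat R :=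
  quat 0 (a * cos (2 * d * t) + b * sin (2 * d * t))
         (b * cos (2 * d * t) - a * sin (2 * d * t)) (e + d).

Lemma qexp_k s t : qexp 0 0 s t = quat (cos (s * t)) 0 0 (sin (s * t)).
Proof.
have n1 : qnorm 0 0 1 = 1 :> R by rewrite /qnorm !expr0n expr1n !add0r sqrtr1.
have := qexpZ s 0 0 1 t; rewrite !mulr0 mulr1 => ->.
by rewrite /qexp n1 mul1r divr1 !mulr0 mulr1.
Qed.

Lemma qexp_kVk s t : qexp 0 0 (- s) t * qexp 0 0 s t = 1.
Proof. by have := qexpVK 0 0 s t; rewrite oppr0. Qed.

(** Conjugation by [exp (t d k)] rotates the plane of [i] and [j] by twice the
    angle, hence the double angle [2 d t]. *)
Lemma helix_conj t :
  quat 0 a b e * qexp 0 0 d t = qexp 0 0 d t * (helix_velocity t - quat 0 0 0 d).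
Proof.
have cs := cos2Dsin2 (d * t).
have -> : helix_velocity t - quat 0 0 0 d =
    quat 0 (a * (cos (d * t) ^+ 2 - sin (d * t) ^+ 2) + b * (2 * sin (d * t) * cos (d * t)))
           (b * (cos (d * t) ^+ 2 - sin (d * t) ^+ 2) - a * (2 * sin (d * t) * cos (d * t))) e.
  rewrite /helix_velocity quatN quatD.
  have -> : 2 * d * t = d * t + d * t by ring.
  by rewrite cosD sinD; congr quat; ring.
rewrite qexp_k; move: (cos (d * t)) (sin (d * t)) cs => C S cs.
rewrite !quatM; congr quat; try by ring.
- transitivity ((C ^+ 2 + S ^+ 2) * (a * C + b * S)); last by ring.
  by rewrite cs; ring.
- transitivity ((C ^+ 2 + S ^+ 2) * (b * C - a * S)); last by ring.
  by rewrite cs; ring.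
Qed.

Lemma helix_is_velocity t : is_velocity helix t (helix t * helix_velocity t).
Proof.
have := is_velocityM (@qexp_velocity _ a b e t) (@qexp_velocity _ 0 0 d t).
congr is_velocity; rewrite -[X in X + _]mulrA helix_conj /helix mulrBr.
by rewrite mulrBr !mulrA subrK.
Qed.

Lemma helix_invK t : helix_inv t * helix t = 1.
Proof.
rewrite /helix_inv /helix mulrA -[X in X * _]mulrA qexpVK mulr1.
exact: qexp_kVk.
Qed.

Lemma helix_inv_is_velocity t :
  is_velocity helix_inv t (- (helix_velocity t * helix_inv t)).
Proof.
have kkV : qexp 0 0 d t * qexp 0 0 (- d) t = 1.
  by have := qexp_kVk (- d) t; rewrite opprK.
have conj : qexp 0 0 (- d) t * quat 0 a b e =
    (helix_velocity t - quat 0 0 0 d) * qexp 0 0 (- d) t.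
  rewrite -[LHS]mulr1 -kkV mulrA -[X in X * _]mulrA helix_conj.
  by rewrite mulrA qexp_kVk mul1r.
have := is_velocityM (@qexp_velocity _ 0 0 (- d) t) (@qexp_velocity _ (- a) (- b) (- e) t).
congr is_velocity; rewrite !qexpC.
have -> : quat 0 0 0 (- d) = - quat 0 0 0 d by rewrite quatN oppr0.
have -> : quat 0 (- a) (- b) (- e) = - quat 0 a b e by rewrite quatN oppr0.
rewrite [X in _ + X]mulrA mulrN conj mulrBl !mulNr -opprD -mulrDl.
by rewrite [X in X * _]addrC subrK /helix_inv mulrA.
Qed.

Lemma helix0 : helix 0 = 1.
Proof. by rewrite /helix !qexp0 mulr1. Qed.

Lemma helix_inv0 : helix_inv 0 = 1.
Proof. by rewrite /helix_inv !qexp0 mulr1. Qed.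

Lemma helix_velocity0 : helix_velocity 0 = quat 0 a b (e + d).
Proof. by rewrite /helix_velocity mulr0 cos0 sin0; congr quat; ring. Qed.

Lemma helix_SU2 t : SU2 (helix t).
Proof. by apply: SU2M; exact: qexp_SU2. Qed.

(** If [sigma] has the frame velocity of [helix], then [sigma * helix^-1] has
    zero velocity. *)
Lemma helix_unique (D : set R) (sigma : R -> mat R) :
  is_interval D -> D 0 -> sigma 0 = 1 ->
  (forall t, D t -> is_velocity sigma t (sigma t * helix_velocity t)) ->
  forall t, D t -> sigma t = helix t.
Proof.
move=> Ditv D0 sigma0 dsigma t Dt.
pose f s := sigma s * helix_inv s.
have df s : D s -> is_velocity f s 0.
  move=> Ds; have := is_velocityM (dsigma s Ds) (@helix_inv_is_velocity s).
  by rewrite mulrN -mulrA subrr.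
have cst := velocity0_interval_cst Ditv df Dt D0.
rewrite /f sigma0 helix_inv0 mulr1 in cst.
by rewrite -[LHS]mulr1 -(helix_invK t) mulrA cst mul1r.
Qed.

(** * Helices as geodesics *)

Section BergerGeodesic.
Variables (c : R) (nabla : connection R).
Hypothesis hnabla : levi_civita (berger_metric c) nabla.
Hypothesis hc : -3 < c.
Hypothesis dE : d = (c - 1) / (c + 3) * (e + d).

(** The left side is how the geodesic equation rotates the horizontal velocity,
    the right side how [helix] does: this is what determines [d]. *)
Lemma rotation_speed y : 2 * ((c - 1) / (c + 3)) * y * (e + d) = 2 * d * y.
Proof.
transitivity (2 * ((c - 1) / (c + 3) * (e + d)) * y); first by ring.
by rewrite -dE.
Qed.

Lemma helix_geodesic : geodesic_on nabla setT helix.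
Proof.
pose V0 t := a * cos (2 * d * t) + b * sin (2 * d * t).
pose V1 t := b * cos (2 * d * t) - a * sin (2 * d * t).
have V1E : V1 = fun t => b * cos (2 * d * t) + (- a) * sin (2 * d * t).
  by apply/funext => t; rewrite /V1 mulNr.
have dV0 t : is_derive t 1 V0 (2 * d * V1 t) by exact: rotation_ode_solution.
have dV1 t : is_derive t 1 V1 (- (2 * d * V0 t)).
  rewrite V1E; have := rotation_ode_solution (2 * d) b (- a) t.
  move=> h; refine (is_derive_eq h _); rewrite /V0; ring.
pose v (i : 'I_3) := if i == o0 then V0 else if i == o1 then V1 else fun=> e + d.
have dv2 t : is_derive t 1 (v o2) 0 by exact: is_derive_cst.
exists v => t _; split.
- exact: helix_SU2.
- by rewrite frame_comb; exact: helix_is_velocity.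
- case=> [[|[|[|//]]] ?].
  + by have [] := dV0 t.
  + by have [] := dV1 t.
  + by have [] := dv2 t.
- rewrite (covariant_derivativeE hnabla hc _ (helix_SU2 t)) !derive1E.
  have [_ ->] := dV0 t; have [_ ->] := dV1 t; have [_ ->] := dv2 t.
  by rewrite /v /= !rotation_speed subrr addNr quat0 mulr0.
Qed.

(** The geodesic equation is integrated in two steps: the velocity in the frame
    satisfies an autonomous linear equation once its vertical component is known
    to be constant, and it then determines the curve by [helix_unique]. *)
Lemma helix_geodesic_unique (D : set R) (sigma : R -> mat R) :
  is_interval D -> D 0 ->
  geodesic_from_1 nabla D (quat 0 a b (e + d)) sigma ->
  forall t, D t -> sigma t = helix t.
Proof.
move=> Ditv D0 [[v geo] sigma0 dsigma0].
have dv i t : D t -> is_derive t 1 (v i) (derive1 (v i) t).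
  by move=> /geo[_ _ dv _]; split; [exact: dv|rewrite derive1E].
have v_at0 : [/\ v o0 0 = a, v o1 0 = b & v o2 0 = e + d].
  have [_ V _ _] := geo 0 D0; have := is_velocity_unique V dsigma0.
  by rewrite frame_comb sigma0 mul1r => /quat_inj[].
have ode t : D t -> let mu := (c - 1) / (c + 3) in
   [/\ derive1 (v o0) t = 2 * mu * v o1 t * v o2 t,
       derive1 (v o1) t = - (2 * mu * v o0 t * v o2 t) & derive1 (v o2) t = 0].
  move=> Dt; have [Gt _ _] := geo t Dt; rewrite (covariant_derivativeE hnabla hc _ Gt).
  rewrite -(mulr0 (sigma t)) => /(mulrI (SU2_unit Gt)).
  rewrite -quat0 => /quat_inj[_ /subr0_eq v0' /addr0_eq v1' v2'].
  by split; rewrite // -[LHS]opprK v1'.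
have [v00 v10 v20] := v_at0.
have v2 t : D t -> v o2 t = e + d.
  move=> Dt; rewrite -v20; apply: (derive0_interval_cst Ditv) => // s Ds.
  by have [_ _ <-] := ode s Ds; exact: dv.
have rot := @rotation_ode_unique R D (v o0) (v o1) (2 * d) Ditv D0.
apply: (helix_unique Ditv D0 sigma0) => t Dt.
have [_ V _ _] := geo t Dt; move: V; rewrite frame_comb /helix_velocity (v2 t Dt).
have [s Ds|s Ds|-> ->] := rot _ _ t Dt.
- by rewrite -rotation_speed -(v2 s Ds); have [<- _ _] := ode s Ds; exact: dv.
- by rewrite -rotation_speed -(v2 s Ds); have [_ <- _] := ode s Ds; exact: dv.
by rewrite v00 v10.
Qed.

End BergerGeodesic.

End Helix.

(** * The geodesics through the identity *)

Unset Implicit Arguments.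

Theorem theorem4p1 (R : realType) (c : R) (hc : -3 < c)
    (nabla : connection R) (hnabla : levi_civita (berger_metric c) nabla)
    (X Xk Xm : mat R) (hXk : kfrak Xk) (hXm : mfrak Xm) (hX : X = Xk + Xm) :
  let Xhat := hat c Xk Xm in
  let gamma := fun t : R => act (expGK (t%:C *: Xhat)) 1 in
  [/\ pfrak c Xhat,
      geodesic_from_1 nabla setT X gamma,
      forall (D : set R) (sigma : R -> mat R),
        open D -> is_interval D -> D 0 -> geodesic_from_1 nabla D X sigma ->
        forall t, D t -> sigma t = gamma t &
      forall t : R,
        gamma t = expG (t%:C *: (Xm + (4 / (c + 3))%:C *: Xk)) *
                  expK (t%:C *: (((c - 1) / (c + 3))%:C *: Xk))].
Proof.
move: hXk hXm hX => [r _ <-] [a [b ->]] ->.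
move=> Xhat gamma.
have c3 : c + 3 != 0 by rewrite gt_eqF //; lra.
pose e := 4 / (c + 3) * r; pose d := (c - 1) / (c + 3) * r.
have edE : e + d = r by rewrite /e /d; field.
have dE : d = (c - 1) / (c + 3) * (e + d) by rewrite edE.
have XmE : a%:C *: bi R + b%:C *: bj R = quat 0 a b 0.
  by rewrite bi_quat bj_quat !quatZ quatD; congr quat; ring.
have XE : r%:C *: bk R + (a%:C *: bi R + b%:C *: bj R) = quat 0 a b (e + d).
  by rewrite XmE bk_quat quatZ quatD edE; congr quat; ring.
have leftE :
    (a%:C *: bi R + b%:C *: bj R) + (4 / (c + 3))%:C *: (r%:C *: bk R) = quat 0 a b e.
  by rewrite XmE bk_quat !quatZ quatD; congr quat; rewrite /e; ring.
have rightE : ((c - 1) / (c + 3))%:C *: (r%:C *: bk R) = quat 0 0 0 d.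
  by rewrite bk_quat !quatZ; congr quat; rewrite /d; ring.
have gammaE : gamma = helix a b e d.
  apply/funext => t; rewrite /gamma /Xhat /hat leftE scaleNr rightE.
  (* The action inverts the second factor, which undoes the sign in [hat]. *)
  rewrite quatN oppr0 expGKZ /act /= mulr1 /helix; congr (_ * _).
  apply: (mulrI (SU2_unit (qexp_SU2 0 0 (- d) t))).
  by rewrite qexp_kVk divrr //; exact/SU2_unit/qexp_SU2.
split.
- exists (a%:C *: bi R + b%:C *: bj R), ((4 / (c + 3))%:C *: (r%:C *: bk R)); split.
  + by exists a, b.
  + by exists (4 / (c + 3) * r) => //; rewrite scalerA -rmorphM.
  + have -> : ((1 - c) / 4)%:C *: ((4 / (c + 3))%:C *: (r%:C *: bk R)) =
        - ((c - 1) / (c + 3))%:C *: (r%:C *: bk R); last by [].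
      by rewrite scaleNr bk_quat !quatZ quatN; congr quat; field.
- rewrite gammaE XE; split.
  + exact: (@helix_geodesic _ a b e d c nabla hnabla hc dE).
  + exact: helix0.
  + by have := @helix_is_velocity _ a b e d 0; rewrite helix0 mul1r helix_velocity0.
- move=> D sigma _ Ditv D0 geo t Dt; rewrite gammaE.
  rewrite XE in geo.
  exact: (helix_geodesic_unique hnabla hc dE Ditv D0 geo).
- by move=> t; rewrite gammaE leftE rightE expGZ expKZ.
Qed.
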